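(* Let $\chi(p)$ be a univariate formula and let $\Lambda$ be a $\chi$-logic. Then for every formula $\phi$: $\phi\in\Lambda$ if and only if $\mathsf{Var}^\chi(\Lambda)\vDash^\chi\phi$, that is, if and only if $H\vDash^\chi\phi$ for every $H\in\mathsf{Var}^\chi(\Lambda)$. Equivalently, $\mathsf{Log}^\chi(\mathsf{Var}^\chi(\Lambda))=\Lambda$.
   Context: Formulas are built from an infinite set $\mathrm{AP}$ of atomic propositions and $\bot$ using $\land,\lor,\to$; $\neg\phi:=\phi\to\bot$, $\top:=\bot\to\bot$, and $\phi\leftrightarrow\psi:=(\phi\to\psi)\land(\psi\to\phi)$. $\mathtt{IPC}$ is the set of theorems of intuitionistic propositional logic. A univariate formula $\chi(p)$ is a formula in which no atomic proposition other than $p$ occurs. Put $\chi^0(p):=p$ and $\chi^{k+1}(p):=\chi(\chi^{k}(p))$. By Ruitenburg's theorem there is $n$ with $\chi^n\leftrightarrow\chi^{n+2}\in\mathtt{IPC}$; the least such $n$ is the index of $\chi$. $\chi$-logics: for a set of formulas $\Gamma$, the $\chi$-logic generated by $\Gamma$ is the smallest set of formulas $\Gamma^\chi$ such that (i) $\mathtt{IPC}\subseteq\Gamma^\chi$; (ii) $\phi[\sigma]\in\Gamma^\chi$ for all $\phi\in\Gamma$ and all substitutions $\sigma$; (iii) $\chi^2(q)\leftrightarrow q\in\Gamma^\chi$ for every atomic proposition $q$; (iv) $\Gamma^\chi$ is closed under modus ponens. A $\chi$-logic is a set of formulas of the form $\Gamma^\chi$. Algebraic semantics: for a Heyting algebra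 $H$ and $V:\mathrm{AP}\to H$, $[\![\phi]\!]^H_V$ is the usual recursive interpretation. Let $\boldsymbol\chi:H\to H$ be $a\mapsto[\![\chi(p)]\!]^H_{[p\mapsto a]}$. With $n$ the index of $\chi$, the $\chi$-core of $H$ is $H^\chi:=\boldsymbol\chi^n[H]$. A $\chi$-valuation is a map $\sigma:\mathrm{AP}\to H$ with $\sigma[\mathrm{AP}]\subseteq H^\chi$. $H\vDash^\chi\phi$ means $[\![\phi]\!]^H_\sigma=1_H$ for every $\chi$-valuation $\sigma$. For a set of formulas $\Gamma$, $\mathsf{Var}^\chi(\Gamma)$ is the class of all Heyting algebras $H$ with $H\vDash^\chi\phi$ for all $\phi\in\Gamma$; for a class $\mathcal C$ of Heyting algebras, $\mathsf{Log}^\chi(\mathcal C)$ is the set of formulas $\phi$ with $H\vDash^\chi\phi$ for all $H\in\mathcal C$. *)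

(* Defs.v *)
From HB Require Import structures.
From mathcomp Require Import all_boot all_order.
From mathcomp Require Import boolp classical_sets functions cardinality.

Set Implicit Arguments.
Unset Strict Implicit.
Unset Printing Implicit Defensive.

Local Open Scope classical_set_scope.

HB.mixin Record TBLattice_isHeyting d T of Order.TBLattice d T := {
  himp : T -> T -> T;
  le_himp : forall a b c : T,
    (a <= himp b c)%O = (Order.meet a b <= c)%O
}.

#[short(type="heytingType")]
HB.structure Definition Heyting d :=
  {T of Order.TBLattice d T & TBLattice_isHeyting d T}.

Inductive form (AP : Type) : Type :=
| Atom of AP
| Bot
| And of form AP & form AP
| Or of form AP & form AP
| Imp of form AP & form AP.

Arguments Bot {AP}.

Definition Iff (AP : Type) (phi psi : form AP) : form AP :=
  And (Imp phi psi) (Imp psi phi).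

Fixpoint atoms (AP : Type) (phi : form AP) : set AP :=
  match phi with
  | Atom q => [set q]
  | Bot => set0
  | And a b | Or a b | Imp a b => atoms a `|` atoms b
  end.

Fixpoint subst (AP : Type) (s : AP -> form AP) (phi : form AP) : form AP :=
  match phi with
  | Atom q => s q
  | Bot => Bot
  | And a b => And (subst s a) (subst s b)
  | Or a b => Or (subst s a) (subst s b)
  | Imp a b => Imp (subst s a) (subst s b)
  end.

Inductive IPC (AP : Type) : form AP -> Prop :=
| IPC_K a b : IPC (Imp a (Imp b a))
| IPC_S a b c :
    IPC (Imp (Imp a (Imp b c)) (Imp (Imp a b) (Imp a c)))
| IPC_andI a b : IPC (Imp a (Imp b (And a b)))
| IPC_andEl a b : IPC (Imp (And a b) a)
| IPC_andEr a b : IPC (Imp (And a b) b)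
| IPC_orIl a b : IPC (Imp a (Or a b))
| IPC_orIr a b : IPC (Imp b (Or a b))
| IPC_orE a b c : IPC (Imp (Imp a c) (Imp (Imp b c) (Imp (Or a b) c)))
| IPC_botE a : IPC (Imp Bot a)
| IPC_MP a b : IPC (Imp a b) -> IPC a -> IPC b.

Definition univariate (AP : Type) (p : AP) (chi : form AP) : Prop :=
  atoms chi `<=` [set p].

(* chi(psi) for a formula chi univariate in p: as p is the only atom that can
   occur in chi, replacing every atom by psi is replacing p by psi. *)
Definition fapp (AP : Type) (chi psi : form AP) : form AP :=
  subst (fun=> psi) chi.

(* fpow chi k psi is chi^k(psi). *)
Definition fpow (AP : Type) (chi : form AP) (k : nat) (psi : form AP) :
    form AP :=
  iter k (fapp chi) psi.

Definition is_chi_index (AP : Type) (p : AP) (chi : form AP) (n : nat) : Prop :=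
  let stable m := IPC (Iff (fpow chi m (Atom p)) (fpow chi m.+2 (Atom p))) in
  stable n /\ forall m, stable m -> (n <= m)%N.

(* The index exists by Ruitenburg's theorem when chi is univariate in p; the
   default value 0 is then never used. *)
Definition chi_index (AP : Type) (p : AP) (chi : form AP) : nat :=
  xget 0%N (is_chi_index p chi).

Inductive chi_closure (AP : Type) (chi : form AP) (Gamma : set (form AP)) :
    set (form AP) :=
| chi_IPC phi : IPC phi -> chi_closure chi Gamma phi
| chi_inst phi (s : AP -> form AP) :
    Gamma phi -> chi_closure chi Gamma (subst s phi)
| chi_atom (q : AP) : chi_closure chi Gamma (Iff (fpow chi 2 (Atom q)) (Atom q))
| chi_MP phi psi : chi_closure chi Gamma (Imp phi psi) ->
    chi_closure chi Gamma phi -> chi_closure chi Gamma psi.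

Definition chi_logic (AP : Type) (chi : form AP) (Lambda : set (form AP)) :
    Prop :=
  exists Gamma : set (form AP), Lambda = chi_closure chi Gamma.

Fixpoint interp (AP : Type) d (H : heytingType d) (V : AP -> H)
    (phi : form AP) : H :=
  match phi with
  | Atom q => V q
  | Bot => \bot%O
  | And a b => Order.meet (interp V a) (interp V b)
  | Or a b => Order.join (interp V a) (interp V b)
  | Imp a b => himp (interp V a) (interp V b)
  end.

(* The map a |-> [[chi(p)]] under [p |-> a]; only the value at p matters. *)
Definition chi_op (AP : Type) (chi : form AP) d (H : heytingType d) (a : H) :
    H :=
  interp (fun=> a) chi.

Definition chi_core (AP : Type) (p : AP) (chi : form AP) d
    (H : heytingType d) : set H :=
  range (iter (chi_index p chi) (@chi_op AP chi d H)).

Arguments chi_core {AP} p chi {d} H.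

Definition chi_valuation (AP : Type) (p : AP) (chi : form AP) d
    (H : heytingType d) (V : AP -> H) : Prop :=
  range V `<=` chi_core p chi H.

Definition chi_valid (AP : Type) (p : AP) (chi : form AP) d
    (H : heytingType d) (phi : form AP) : Prop :=
  forall V : AP -> H, chi_valuation p chi V -> interp V phi = \top%O.

(* Displays are only phantom labels on order structures: quantifying over
   them makes the classes range over all Heyting algebras.  A class is a plain
   predicate rather than a set (heytingType d): the type of all Heyting
   algebras is large, and instantiating the universe of the argument of set
   with it would force carriers of Heyting algebras to lie strictly below the
   universe of choice types. *)
Definition heyting_class : Type := forall d, heytingType d -> Prop.

Definition chi_Var (AP : Type) (p : AP) (chi : form AP)
    (Gamma : set (form AP)) : heyting_class :=
  fun d H => forall phi, Gamma phi -> chi_valid p chi H phi.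

Definition chi_Log (AP : Type) (p : AP) (chi : form AP) (C : heyting_class) :
    set (form AP) :=
  [set phi | forall d (H : heytingType d), C d H -> chi_valid p chi H phi].

(* Main.v *)
(** Refutation of a formula outside Lambda takes place in the Lindenbaum
    algebra of Lambda, under the valuation [q |-> [q]], which is a
    chi-valuation since [q <-> chi^2(q)] is in Lambda.  That algebra lies in
    Var^chi(Lambda) because Lambda is closed under substitutions
    [q |-> chi^n(psi_q)], [n] being the index of chi; this closure uses that
    [chi^n <-> chi^(n+2)] is an IPC theorem, i.e. Ruitenburg's theorem.

    For univariate chi, Ruitenburg's theorem holds with [chi^2 <-> chi^4]: in
    any Heyting algebra,
    [b /\ chi(b) = b /\ chi(1)] and [~b /\ chi(b) = ~b /\ chi(0)], where
    chi(0), chi(1) are 0 or 1, and [~~b /\ chi(b)] is 0, [b] or [~~b], because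
    [{0, b, 1}] is closed under the operations modulo the filter of [~~b]. *)
From HB Require Import structures.
Require Import Defs.
From mathcomp Require Import all_boot all_order.
From mathcomp Require Import boolp classical_sets functions cardinality.

Set Implicit Arguments.
Unset Strict Implicit.
Unset Printing Implicit Defensive.

Import Order.LTheory.

(** * Heyting algebra identities and congruence modulo a principal filter *)

Section HeytingAlgebra.
Local Open Scope order_scope.
Variables (d : Order.disp_t) (H : heytingType d).
Implicit Types a b c x y : H.

Definition hneg x : H := himp x \bot.

Lemma meet_himp_le a b : a `&` himp a b <= b.
Proof. by rewrite meetC -le_himp. Qed.

Lemma himp_eq1 a b : a <= b -> himp a b = \top.
Proof. by move=> ab; apply/le_anti; rewrite lex1 le_himp meet1x. Qed.

Lemma himp0x b : himp \bot b = \top.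
Proof. exact/himp_eq1/le0x. Qed.

Lemma himpx1 a : himp a \top = \top.
Proof. exact/himp_eq1/lex1. Qed.

Lemma himpxx a : himp a a = \top.
Proof. exact/himp_eq1/lexx. Qed.

Lemma himp1x b : himp \top b = b.
Proof.
apply/le_anti; rewrite le_himp meetx1 lexx andbT.
by rewrite -[X in X <= _]meet1x meet_himp_le.
Qed.

Lemma meet_joinr c x y : c `&` (x `|` y) = (c `&` x) `|` (c `&` y).
Proof.
apply/le_anti/andP; split; last first.
  by rewrite leUx !leI2 // ?leUl ?leUr.
by rewrite meetC -le_himp leUx !le_himp ![_ `&` c]meetC leUl leUr.
Qed.

Lemma meet_hneg x : x `&` hneg x = \bot.
Proof. by apply/le_anti; rewrite le0x andbT meet_himp_le. Qed.

Lemma le_hneg x y : (x <= hneg y) = (x `&` y == \bot).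
Proof. by rewrite le_himp lex0. Qed.

Lemma le_hnegK x : x <= hneg (hneg x).
Proof. by rewrite le_hneg meet_hneg. Qed.

Lemma hneg3 x : hneg (hneg (hneg x)) = hneg x.
Proof.
apply/le_anti; rewrite le_hnegK andbT le_hneg -lex0.
apply: le_trans (_ : hneg (hneg (hneg x)) `&` hneg (hneg x) <= _).
  by rewrite leI2 // le_hnegK.
by rewrite meetC meet_hneg.
Qed.

(** Equality of meets with [c] is congruence modulo the filter of [c]. By residuation it suffices
    that [c], [x'] and [himp x y] together lie below [y']: under [c], [x'] may be traded for [x],
    and the resulting [y] for [y']. *)
Lemma himp_cong_le c x x' y y' :
  c `&` x = c `&` x' -> c `&` y = c `&` y' ->
  c `&` himp x y <= c `&` himp x' y'.
Proof.
move=> ex ey; rewrite lexI leIl /= le_himp -meetA [himp _ _ `&` _]meetC.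
apply: le_trans (_ : c `&` y' <= _); last exact: leIr.
rewrite -ey lexI leIl /= meetA -ex -meetA.
exact: le_trans (leIr _ _) (meet_himp_le _ _).
Qed.

Lemma himp_cong c x x' y y' :
  c `&` x = c `&` x' -> c `&` y = c `&` y' ->
  c `&` himp x y = c `&` himp x' y'.
Proof. by move=> ex ey; apply/le_anti; rewrite !himp_cong_le. Qed.

Lemma join_cong c x x' y y' :
  c `&` x = c `&` x' -> c `&` y = c `&` y' ->
  c `&` (x `|` y) = c `&` (x' `|` y').
Proof. by rewrite !meet_joinr => -> ->. Qed.

Lemma meet_cong c x x' y y' :
  c `&` x = c `&` x' -> c `&` y = c `&` y' ->
  c `&` (x `&` y) = c `&` (x' `&` y').
Proof. by move=> ex ey; rewrite meetA ex meetAC ey meetAC meetA. Qed.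

(** * Iterates of a univariate polynomial on a Heyting algebra *)

Section Univariate.
Variables (AP : Type) (chi : form AP).
Local Notation f := (@chi_op AP chi d H).

Lemma chi_op_cong c a b : c `&` a = c `&` b -> c `&` f a = c `&` f b.
Proof.
rewrite /chi_op => ab; elim: chi => //= x IHx y IHy.
- exact: meet_cong.
- exact: join_cong.
- exact: himp_cong.
Qed.

Lemma chi_op_bool b :
  b = \bot \/ b = \top -> f b = \bot \/ f b = \top.
Proof.
rewrite /chi_op => b01.
elim: chi => //= [|x [->|->] y [->|->]|x [->|->] y [->|->]|x [->|->] y [->|->]];
  rewrite ?meet0x ?meet1x ?join0x ?join1x ?himp1x ?himp0x;
  by [left|right].
Qed.

Lemma chi_op_three b :
  [\/ hneg (hneg b) `&` f b = \bot, hneg (hneg b) `&` f b = b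
    | hneg (hneg b) `&` f b = hneg (hneg b)].
Proof.
set c := hneg (hneg b).
have cb : c `&` b = b by apply/meet_idPr; exact: le_hnegK.
(* The only operation that leads out of {0, b, 1}, up to this congruence, is [himp b \bot]; below
   [~~b] it becomes 0. *)
have cnb : c `&` himp b \bot = c `&` \bot.
  by rewrite meetx0 meetC; exact: meet_hneg.
suff [fb|fb|fb] : [\/ c `&` f b = c `&` \bot, c `&` f b = c `&` b
                    | c `&` f b = c `&` \top]; rewrite ?fb.
- by constructor 1; rewrite meetx0.
- by constructor 2.
- by constructor 3; rewrite meetx1.
rewrite /chi_op; elim: chi => /= [_||x IHx y IHy|x IHx y IHy|x IHx y IHy].
- by constructor 2.
- by constructor 1.
- by case: IHx => ex; case: IHy => ey; rewrite (meet_cong ex ey)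
    ?meet0x ?meet1x ?meetxx ?meetx0 ?meetx1;
    by [constructor 1|constructor 2|constructor 3].
- by case: IHx => ex; case: IHy => ey; rewrite (join_cong ex ey)
    ?join0x ?join1x ?joinxx ?joinx0 ?joinx1;
    by [constructor 1|constructor 2|constructor 3].
- by case: IHx => ex; case: IHy => ey; rewrite (himp_cong ex ey)
    ?cnb ?himp1x ?himp0x ?himpx1 ?himpxx;
    by [constructor 1|constructor 2|constructor 3].
Qed.

Lemma chi_op_top b : b `&` f b = b `&` f \top.
Proof. by apply: chi_op_cong; rewrite meetxx meetx1. Qed.

Lemma chi_op_bot b : hneg b `&` f b = hneg b `&` f \bot.
Proof. by apply: chi_op_cong; rewrite meetC meet_hneg meetx0. Qed.

(** Case split on f(1) and f(0). If f(1) = 0, then f is constantly 0 or is negation. If f(1) = 1,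
    then f is inflationary; moreover f(0) = 0 bounds f by double negation, while f(0) = 1 makes
    every f(b) dense. *)
Lemma chi_op_iter24 b : iter 2 f b = iter 4 f b.
Proof.
have [f1|f1] := chi_op_bool (or_intror (erefl \top : \top = \top :> H)).
  have f_hneg x : f x <= hneg x.
    by rewrite le_hneg meetC chi_op_top f1 meetx0.
  have [f0|f0] := chi_op_bool (or_introl (erefl \bot : \bot = \bot :> H)).
    (* [f x] lies below [~x], and below [~x] it agrees with f(0) = 0. *)
    have f_bot x : f x = \bot.
      apply/le_anti; rewrite le0x andbT -f0 -[f \bot](meetx1 _).
      rewrite f0 meet0x -(meetx0 (hneg x)) -f0 -chi_op_bot.
      by rewrite lexI lexx f_hneg.
    by rewrite /= !f_bot.
  have fE x : f x = hneg x.
    apply/le_anti; rewrite f_hneg -[hneg x](meetx1 _) -f0 -chi_op_bot.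
    exact: leIr.
  by rewrite /= !fE hneg3.
have f_ge x : x <= f x.
  by rewrite -[X in X <= _](meetx1 _) -f1 -chi_op_top leIr.
have [f0|f0] := chi_op_bool (or_introl (erefl \bot : \bot = \bot :> H)).
  have f_le x : f x <= hneg (hneg x).
    by rewrite le_hneg meetC chi_op_bot f0 meetx0.
  have fnn x : f (hneg (hneg x)) = hneg (hneg x).
    by apply/le_anti; rewrite f_ge andbT (le_trans (f_le _)) // hneg3.
  (* Each of the three possible values of [f b] turns out to be a fixed point of f. *)
  have := chi_op_three b; rewrite (meet_idPr (f_le b)) => -[] fb.
  - have b0 : b = \bot by apply/le_anti; rewrite le0x andbT -fb f_ge.
    by rewrite /= b0 !f0.
  - by rewrite /= !fb.
  - by rewrite /= fb !fnn.
(* From b <= f(b) follows ~f(b) <= ~b, and f(0) = 1 gives ~b <= f(b); so ~f(b) lies below f(b) and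
   is 0. *)
have f_dense : hneg (f b) = \bot.
  have nf : hneg (f b) <= hneg b.
    rewrite le_hneg -lex0 meetC -(meet_hneg (f b)).
    by rewrite leI2 // f_ge.
  apply/le_anti; rewrite le0x andbT -(meet_hneg (f b)) lexI lexx andbT.
  apply: le_trans nf _.
  by rewrite -[hneg b](meetx1 _) -f0 -chi_op_bot leIr.
(* As ~~f(b) = 1, the trichotomy at f(b) gives f(f(b)) itself: it is 0, f(b) or 1. *)
have := chi_op_three (f b).
rewrite f_dense /(hneg \bot) himpxx meet1x => -[] ff.
- have fb0 : f b = \bot by apply/le_anti; rewrite le0x andbT -ff f_ge.
  by move: ff; rewrite fb0 => ff; rewrite /= fb0 !ff.
- by rewrite /= !ff.
- by rewrite /= ff !f1.
Qed.

End Univariate.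
End HeytingAlgebra.

(** * Derivability in a set of formulas containing IPC and closed under modus ponens *)

Record theory (AP : Type) := Theory {
  theorems :> form AP -> Prop;
  theory_IPC : forall phi, IPC phi -> theorems phi;
  theory_MP : forall phi psi,
    theorems (Imp phi psi) -> theorems phi -> theorems psi
}.

Section Derivability.
Variables (AP : Type) (T : theory AP).
Implicit Types a b c : form AP.

Lemma thm_weaken a b : T b -> T (Imp a b).
Proof. by apply: theory_MP; apply/theory_IPC/IPC_K. Qed.

Lemma thm_distr a b c : T (Imp a (Imp b c)) -> T (Imp a b) -> T (Imp a c).
Proof.
by move=> abc; apply: theory_MP; move: abc; apply: theory_MP;
  apply/theory_IPC/IPC_S.
Qed.

Lemma thm_refl a : T (Imp a a).
Proof. by apply: (@thm_distr _ (Imp a a)); apply/theory_IPC/IPC_K. Qed.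

Lemma thm_trans a b c : T (Imp a b) -> T (Imp b c) -> T (Imp a c).
Proof. by move=> ab bc; apply: thm_distr ab; exact: thm_weaken. Qed.

(** This and the next two lemmas are the universal properties of meet, join and implication in the
    preorder of provable implication; they yield the Heyting structure of the quotient. *)
Lemma thm_and_le a b c : T (Imp a (And b c)) <-> T (Imp a b) /\ T (Imp a c).
Proof.
split=> [abc|[ab ac]].
  by split; apply: thm_trans abc _; apply: theory_IPC;
    [exact: IPC_andEl|exact: IPC_andEr].
by apply: thm_distr ac; apply: thm_trans ab _; apply/theory_IPC/IPC_andI.
Qed.

Lemma thm_or_le a b c : T (Imp (Or a b) c) <-> T (Imp a c) /\ T (Imp b c).
Proof.
split=> [abc|[ac bc]].
  by split; apply: thm_trans abc; apply: theory_IPC;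
    [exact: IPC_orIl|exact: IPC_orIr].
by apply: theory_MP bc; apply: theory_MP ac; apply/theory_IPC/IPC_orE.
Qed.

Lemma thm_imp_le a b c : T (Imp a (Imp b c)) <-> T (Imp (And a b) c).
Proof.
split=> [abc|abc].
  apply: (@thm_distr _ b); last by apply/theory_IPC/IPC_andEr.
  by apply: thm_trans abc; apply/theory_IPC/IPC_andEl.
apply: (@thm_trans _ (Imp b (And a b))); first by apply/theory_IPC/IPC_andI.
by apply: theory_MP (thm_weaken b abc); apply/theory_IPC/IPC_S.
Qed.

Lemma thm_and a b : T (And a b) <-> T a /\ T b.
Proof.
split=> [ab|[Ta Tb]].
  by split; apply: theory_MP ab; apply: theory_IPC;
    [exact: IPC_andEl|exact: IPC_andEr].
by apply: theory_MP Tb; apply: theory_MP Ta; apply/theory_IPC/IPC_andI.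
Qed.

End Derivability.

HB.instance Definition _ (AP : Type) := gen_eqMixin (form AP).
HB.instance Definition _ (AP : Type) := gen_choiceMixin (form AP).

(** * The Lindenbaum algebra of a theory *)

Section Lindenbaum.
Local Open Scope order_scope.
Local Open Scope quotient_scope.
Variables (AP : Type) (T : theory AP).
Implicit Types phi psi : form AP.

Definition thm_equiv phi psi : bool := `[< T (Iff phi psi) >].

Lemma thm_equivP phi psi :
  reflect (T (Imp phi psi) /\ T (Imp psi phi)) (thm_equiv phi psi).
Proof. by apply: (iffP (asboolP _)) => /thm_and. Qed.

Lemma thm_equiv_refl : reflexive thm_equiv.
Proof. by move=> phi; apply/thm_equivP; split; exact: thm_refl. Qed.

Lemma thm_equiv_sym : symmetric thm_equiv.
Proof. by move=> phi psi; apply/thm_equivP/thm_equivP => -[]. Qed.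

Lemma thm_equiv_trans : transitive thm_equiv.
Proof.
move=> b a c /thm_equivP[ab ba] /thm_equivP[bc cb]; apply/thm_equivP.
by split; [apply: thm_trans ab bc|apply: thm_trans cb ba].
Qed.

Canonical thm_equiv_rel :=
  EquivRel thm_equiv thm_equiv_refl thm_equiv_sym thm_equiv_trans.

Definition lindenbaum := {eq_quot thm_equiv_rel}.
HB.instance Definition _ := Choice.on lindenbaum.

Definition lclass phi : lindenbaum := \pi_{eq_quot thm_equiv_rel} phi.
Definition lrepr (x : lindenbaum) : form AP :=
  repr (x : {eq_quot thm_equiv_rel}).

Lemma lreprK : cancel lrepr lclass.
Proof. exact: reprK. Qed.

Lemma lclass_eq phi psi : lclass phi = lclass psi <-> T (Iff phi psi).
Proof.
rewrite -[T _]asboolE; split=> [/eqmodP//|].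
by move=> e; apply/eqmodP.
Qed.

(** Order and operations are computed on chosen representatives; [lclass_le], [lclass_meet],
    [lclass_join] and [lclass_himp] show afterwards that the choice is immaterial. *)
Definition lle (x y : lindenbaum) : bool := `[< T (Imp (lrepr x) (lrepr y)) >].

Lemma lle_refl : reflexive lle.
Proof. by move=> x; apply/asboolP; exact: thm_refl. Qed.

Lemma lle_anti : antisymmetric lle.
Proof.
move=> x y /andP[/asboolP xy /asboolP yx].
by rewrite -(lreprK x) -(lreprK y); apply/lclass_eq/thm_and.
Qed.

Lemma lle_trans : transitive lle.
Proof.
move=> y x z /asboolP xy /asboolP yz; apply/asboolP.
exact: thm_trans xy yz.
Qed.

HB.instance Definition _ := Order.Le_isPOrder.Build (Order.Disp tt tt)
  lindenbaum lle_refl lle_anti lle_trans.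

Lemma lclass_le phi psi : (lclass phi <= lclass psi) <-> T (Imp phi psi).
Proof.
have /lclass_eq/thm_and[ra ar] := lreprK (lclass phi).
have /lclass_eq/thm_and[rb br] := lreprK (lclass psi).
split=> [/asboolP ab|ab]; last apply/asboolP.
  by apply: thm_trans ar _; apply: thm_trans ab rb.
by apply: thm_trans ra _; apply: thm_trans ab br.
Qed.

Definition lmeet (x y : lindenbaum) := lclass (And (lrepr x) (lrepr y)).
Definition ljoin (x y : lindenbaum) := lclass (Or (lrepr x) (lrepr y)).
Definition limp (x y : lindenbaum) := lclass (Imp (lrepr x) (lrepr y)).

Lemma le_lmeet (x y z : lindenbaum) :
  (x <= lmeet y z) = (x <= y) && (x <= z).
Proof.
rewrite -{1 2 3}(lreprK x) -{2}(lreprK y) -{2}(lreprK z).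
apply/idP/andP => [/lclass_le/thm_and_le[? ?]|[/lclass_le ? /lclass_le ?]].
  by split; apply/lclass_le.
by apply/lclass_le/thm_and_le.
Qed.

Lemma ljoin_le (x y z : lindenbaum) :
  (ljoin x y <= z) = (x <= z) && (y <= z).
Proof.
rewrite -{2}(lreprK x) -{2}(lreprK y) -{1 2 3}(lreprK z).
apply/idP/andP => [/lclass_le/thm_or_le[? ?]|[/lclass_le ? /lclass_le ?]].
  by split; apply/lclass_le.
by apply/lclass_le/thm_or_le.
Qed.

HB.instance Definition _ := Order.POrder_MeetJoin_isLattice.Build _
  lindenbaum le_lmeet ljoin_le.

Lemma lbot_le (x : lindenbaum) : lclass Bot <= x.
Proof. by rewrite -(lreprK x); apply/lclass_le/theory_IPC/IPC_botE. Qed.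

Lemma le_ltop (x : lindenbaum) : x <= lclass (Imp Bot Bot).
Proof. by rewrite -(lreprK x); apply/lclass_le/thm_weaken/thm_refl. Qed.

HB.instance Definition _ := Order.hasBottom.Build _ lindenbaum lbot_le.
HB.instance Definition _ := Order.hasTop.Build _ lindenbaum le_ltop.

Lemma le_limp (x y z : lindenbaum) :
  (x <= limp y z) = (Order.meet x y <= z).
Proof.
rewrite -{1}(lreprK x) -{2}(lreprK z).
by apply/idP/idP => /lclass_le/thm_imp_le ?; apply/lclass_le.
Qed.

HB.instance Definition _ := TBLattice_isHeyting.Build _ lindenbaum le_limp.

Lemma lclass_meet phi psi :
  Order.meet (lclass phi) (lclass psi) = lclass (And phi psi).
Proof.
apply/le_anti/andP; split; last first.
  by rewrite lexI; apply/andP; split; apply/lclass_le/theory_IPC;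
    [exact: IPC_andEl|exact: IPC_andEr].
rewrite -[X in X <= _]lreprK; apply/lclass_le/thm_and_le.
by split; apply/lclass_le; rewrite lreprK; [exact: leIl|exact: leIr].
Qed.

Lemma lclass_join phi psi :
  Order.join (lclass phi) (lclass psi) = lclass (Or phi psi).
Proof.
apply/le_anti/andP; split.
  by rewrite leUx; apply/andP; split; apply/lclass_le/theory_IPC;
    [exact: IPC_orIl|exact: IPC_orIr].
rewrite -[X in _ <= X]lreprK; apply/lclass_le/thm_or_le.
by split; apply/lclass_le; rewrite lreprK; [exact: leUl|exact: leUr].
Qed.

Lemma lclass_himp phi psi :
  himp (lclass phi) (lclass psi) = lclass (Imp phi psi).
Proof.
apply/le_anti/andP; split; last first.
  by rewrite le_himp lclass_meet; apply/lclass_le/thm_imp_le/thm_refl.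
rewrite -[X in X <= _]lreprK; apply/lclass_le/thm_imp_le/lclass_le.
by rewrite -lclass_meet lreprK -le_himp.
Qed.

(** The truth lemma for an arbitrary substitution: a constant [s] computes [chi_op] on classes,
    powers of chi give the chi-valuations, and the identity gives the refuting valuation. *)
Lemma interp_lclass (s : AP -> form AP) phi :
  interp (fun q => lclass (s q)) phi = lclass (subst s phi).
Proof.
elim: phi => //= a -> b ->.
- exact: lclass_meet.
- exact: lclass_join.
- exact: lclass_himp.
Qed.

Lemma lclass_top phi : lclass phi = \top <-> T phi.
Proof.
have top : T (Imp Bot Bot) by exact: thm_refl.
split=> [/lclass_eq/thm_and[_]|Tphi]; first by move/theory_MP; apply.
by apply/lclass_eq/thm_and; split; exact: thm_weaken.
Qed.

End Lindenbaum.

(** The Lindenbaum construction serves twice: for IPC it turns an identity of Heyting algebras into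
    an IPC theorem, for a chi-logic it gives the refuting algebra. *)
Definition IPC_theory (AP : Type) : theory AP :=
  @Theory AP (@IPC AP) (fun _ => id) (@IPC_MP AP).

Definition chi_theory (AP : Type) (chi : form AP) (Gamma : set (form AP)) :
    theory AP :=
  @Theory AP (chi_closure chi Gamma) (@chi_IPC _ chi Gamma)
    (@chi_MP _ chi Gamma).

(** * Substitution, Ruitenburg's theorem and the index *)

Section Substitution.
Variable AP : Type.
Implicit Types (phi psi chi : form AP) (s t : AP -> form AP).

Lemma subst_subst s t phi : subst s (subst t phi) = subst (subst s \o t) phi.
Proof. by elim: phi => //= a -> b ->. Qed.

Lemma subst_Atom phi : subst (@Atom AP) phi = phi.
Proof. by elim: phi => //= a -> b ->. Qed.

Lemma subst_Iff s phi psi :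
  subst s (Iff phi psi) = Iff (subst s phi) (subst s psi).
Proof. by []. Qed.

Lemma subst_fpow s chi k psi :
  subst s (fpow chi k psi) = fpow chi k (subst s psi).
Proof. by elim: k => //= k IH; rewrite /fapp subst_subst -IH. Qed.

Lemma IPC_subst s phi : IPC phi -> IPC (subst s phi).
Proof.
by elim=> /= *; try constructor; apply: IPC_MP; eassumption.
Qed.

Lemma lclass_fpow (T : theory AP) chi k psi :
  lclass T (fpow chi k psi) = iter k (@chi_op _ chi _ _) (lclass T psi).
Proof.
elim: k => //= k <-; rewrite /chi_op.
exact: esym (interp_lclass _ (fun=> _) _).
Qed.

(** The identity [chi_op_iter24], read at the class of [p] in the Lindenbaum algebra of IPC. *)
Lemma Ruitenburg_univariate p chi :
  IPC (Iff (fpow chi 2 (Atom p)) (fpow chi 4 (Atom p))).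
Proof.
apply/(@lclass_eq _ (IPC_theory AP)).
by rewrite !lclass_fpow chi_op_iter24.
Qed.

(** Stability at 2 makes a least stable exponent exist, so [xget] does not fall back on its
    default. *)
Lemma chi_indexP p chi : is_chi_index p chi (chi_index p chi).
Proof.
apply: xgetPex.
pose stable m :=
  `[< IPC (Iff (fpow chi m (Atom p)) (fpow chi m.+2 (Atom p))) >].
have ex : exists m, stable m.
  by exists 2; apply/asboolP; exact: Ruitenburg_univariate.
case: (ex_minnP ex) => n /asboolP n_stable n_min.
by exists n; split=> // m m_stable; apply: n_min; apply/asboolP.
Qed.

Lemma fpow_chi_index p chi psi :
  IPC (Iff (fpow chi (chi_index p chi) psi)
           (fpow chi (chi_index p chi).+2 psi)).
Proof.
have [/(IPC_subst (fun=> psi)) st _] := chi_indexP p chi.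
by rewrite subst_Iff !subst_fpow in st.
Qed.

End Substitution.

(** * The Lindenbaum algebra of a chi-logic *)

Section ChiLogic.
Variables (AP : Type) (p : AP) (chi : form AP) (Gamma : set (form AP)).
Local Notation n := (chi_index p chi).
Local Notation L := (lindenbaum (chi_theory chi Gamma)).
Local Notation cl := (lclass (chi_theory chi Gamma)).

(** The delicate case is [chi_atom]: an arbitrary substitution gives chi^2(psi) <-> psi, which may
    fail to be derivable, but for psi = chi^n([s q]) it is the stability of the index. *)
Lemma chi_closure_subst_core (s : AP -> form AP) phi :
  chi_closure chi Gamma phi ->
  chi_closure chi Gamma (subst (fun q => fpow chi n (s q)) phi).
Proof.
elim=> {phi} [phi|phi t|q|phi psi _ IH1 _ IH2].
- by move=> /(IPC_subst (fun q => fpow chi n (s q))); exact: chi_IPC.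
- by rewrite subst_subst; exact: chi_inst.
- rewrite subst_Iff subst_fpow; apply/(lclass_eq (chi_theory chi Gamma)).
  by apply/esym/lclass_eq/chi_IPC/fpow_chi_index.
- exact: chi_MP IH1 IH2.
Qed.

Lemma lclass_Atom_iter k q : iter k.*2 (@chi_op _ chi _ _) (cl (Atom q)) = cl (Atom q).
Proof.
elim: k => [//|k IH]; rewrite doubleS iterS iterS IH.
rewrite -[LHS]/(iter 2 _ _) -lclass_fpow.
by apply/lclass_eq/chi_atom.
Qed.

Lemma chi_valuation_lclass : chi_valuation p chi (fun q => cl (Atom q)).
Proof.
(* The preimage of [q] under chi^n is chi^n[q]: the total exponent 2n is even whatever the parity of
   n, and chi^2 fixes [q]. *)
move=> _ [q _ <-]; exists (iter n (@chi_op _ chi _ _) (cl (Atom q))) => //.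
by rewrite -iterD addnn lclass_Atom_iter.
Qed.

Lemma chi_Var_lindenbaum : chi_Var p chi (chi_closure chi Gamma) L.
Proof.
move=> phi Lphi V coreV.
(* Core elements are classes of formulas chi^n(psi); choosing one psi per atom turns the valuation
   into a substitution. *)
have /choice[s sV] q : exists psi, V q = cl (fpow chi n psi).
  have [x _ <-] : chi_core p chi L (V q) by apply: coreV; exists q.
  by exists (lrepr x); rewrite lclass_fpow lreprK.
have -> : V = (fun q => cl (fpow chi n (s q))) by apply/funext.
by rewrite interp_lclass; apply/lclass_top/chi_closure_subst_core.
Qed.

End ChiLogic.

Theorem theorem26 (AP : Type) (AP_infinite : infinite_set [set: AP]%classic)
    (p : AP) (chi : form AP) (chi_univariate : univariate p chi)
    (Lambda : set (form AP)) (Lambda_logic : chi_logic chi Lambda) :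
  (forall phi : form AP,
     Lambda phi <->
     (forall (d : Order.disp_t) (H : heytingType d),
        chi_Var p chi Lambda H -> chi_valid p chi H phi))
  /\ chi_Log p chi (chi_Var p chi Lambda) = Lambda.
Proof.
have main phi : Lambda phi <->
    (forall (d : Order.disp_t) (H : heytingType d),
       chi_Var p chi Lambda H -> chi_valid p chi H phi).
  split=> [Lphi d H|]; first exact.
  case: Lambda_logic => Gamma -> valid.
  have /(_ _ (@chi_valuation_lclass _ p chi Gamma)) :=
    valid _ _ (@chi_Var_lindenbaum _ p chi Gamma).
  (* Under [q |-> [q]] the value of [phi] is its own class, which is top exactly when [phi] is in
     the logic. *)
  by rewrite interp_lclass subst_Atom => /lclass_top.
by split=> //; apply/seteqP; split=> phi /main.
Qed.
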